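(* Let $k$ be a field, $S=k[x_1,\dots,x_n]$, and let $\Delta$ be a simplicial complex on $[n]$ such that $I_\Delta^{(2)}$ is a Cohen-Macaulay ideal. Let $\Gamma$ be the graph of the one-dimensional faces of $\Delta$. Then $\mathrm{diam}(\Gamma)\le2$.
   Context: $[n]=\{1,\dots,n\}$. A simplicial complex on $[n]$ is a collection of subsets of $[n]$ containing $\emptyset$ and closed under taking subsets; $\mathcal F(\Delta)$ is its set of facets (maximal faces). The dimension of a face $F$ is $|F|-1$. $P_F$ is the prime ideal of $S$ generated by the $x_i$ with $i\notin F$; the second symbolic power of the Stanley-Reisner ideal $I_\Delta=\bigcap_{F\in\mathcal F(\Delta)}P_F$ is $I_\Delta^{(2)}=\bigcap_{F\in\mathcal F(\Delta)}P_F^2$. An ideal $I$ is Cohen-Macaulay if $S/I$ is Cohen-Macaulay. The graph $\Gamma$ has as edges the one-dimensional faces of $\Delta$ and as vertices the elements of $[n]$ lying in some one-dimensional face. The distance between two vertices of a graph is the minimal length of paths joining them (infinite if there is none); the diameter $\mathrm{diam}(\Gamma)$ is the maximal distance between two vertices (so $\mathrm{diam}(\Gamma)\le 2$ holds trivially if $\Gamma$ has no vertices). *)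

(* Defs.v *)
From HB Require Import structures.
From mathcomp Require Import all_boot all_order all_algebra ring_quotient.
From mathcomp Require Import boolp mpoly.

Set Implicit Arguments.
Unset Strict Implicit.
Unset Printing Implicit Defensive.

Import GRing.Theory.
Local Open Scope ring_scope.

Section Ideals.
Variable R : comNzRingType.
Implicit Types (I J P Q G : {pred R}) (s : seq R).

(* The set of finite sums of c * g with g in G; it is all of R when G
   generates the unit ideal, so it need not be a (proper) [idealr]. *)
Definition ideal_gen G : {pred R} := [pred f | `[<
  exists r (c g : 'I_r -> R),
    (forall i, g i \in G) /\ f = \sum_(i < r) c i * g i >]].

Definition ideal_mul I J : {pred R} := ideal_gen [pred f | `[<
  exists u v, [/\ u \in I, v \in J & f = u * v] >]].

Lemma ideal_gen_linear G a u v :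
  u \in ideal_gen G -> v \in ideal_gen G -> a * u + v \in ideal_gen G.
Proof.
move=> /asboolP[r [c [g [gG ->]]]] /asboolP[r' [c' [g' [gG' ->]]]].
apply/asboolP; exists (r + r')%N.
exists (fun i => match split i with inl i => a * c i | inr i => c' i end).
exists (fun i => match split i with inl i => g i | inr i => g' i end).
split; first by move=> i; case: (split i).
rewrite big_split_ord /= mulr_sumr; congr (_ + _); apply: eq_bigr => i _.
  by rewrite -[lshift _ _]/(unsplit (inl i)) unsplitK mulrA.
by rewrite -[rshift _ _]/(unsplit (inr i)) unsplitK.
Qed.

Lemma ideal_gen0 G : 0 \in ideal_gen G.
Proof.
apply/asboolP; exists 0%N, (fun=> 0), (fun=> 0).
by split=> [[]//|]; rewrite big_ord0.
Qed.

(* [idealr_closed] only covers proper ideals; the unit ideal is always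
   finitely generated, so nothing is lost here. *)
Definition noetherian : Prop :=
  forall I, idealr_closed I -> exists s, I =i ideal_gen (mem s).

Definition prime_ideal P : Prop := idealr_closed P /\ prime_idealr_closed P.

Definition maximal_ideal P : Prop :=
  idealr_closed P /\
  forall Q, idealr_closed Q -> {subset P <= Q} -> {subset Q <= P}.

(* A chain p 0 < p 1 < ... < p h = P of prime ideals. *)
Definition prime_chain_below P (h : nat) : Prop :=
  exists p : nat -> {pred R},
    [/\ p h =i P,
        forall i, (i <= h)%N -> prime_ideal (p i)
      & forall i, (i < h)%N ->
          {subset p i <= p i.+1} /\ ~ {subset p i.+1 <= p i}].

Definition has_height P (h : nat) : Prop :=
  prime_chain_below P h /\ forall h', prime_chain_below P h' -> (h' <= h)%N.

Definition regular_sequence s : Prop :=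
  1 \notin ideal_gen (mem s) /\
  forall i, (i < size s)%N -> forall y : R,
    s`_i * y \in ideal_gen (mem (take i s)) -> y \in ideal_gen (mem (take i s)).

Definition regular_sequence_in P (d : nat) : Prop :=
  exists s, [/\ regular_sequence s, {subset s <= P} & size s = d].

Definition has_depth P (d : nat) : Prop :=
  regular_sequence_in P d /\
  forall d', regular_sequence_in P d' -> (d' <= d)%N.

(* depth (P, R) = codim P for every maximal ideal P, as in Eisenbud,
   Commutative Algebra, 18.2; both numbers are finite as R is noetherian. *)
Definition cohen_macaulay_ring : Prop :=
  noetherian /\
  forall P, maximal_ideal P -> exists2 d, has_height P d & has_depth P d.

End Ideals.

Definition cohen_macaulay_ideal (R : comNzRingType) (I : idealr R) : Prop :=
  cohen_macaulay_ring {ideal_quot I}.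

(* Not every i : 'I_n need be a vertex of the complex. *)
Record simplicial_complex (n : nat) := SimplicialComplex {
  faces :> {set {set 'I_n}};
  face0 : set0 \in faces;
  faceS : forall F G : {set 'I_n}, F \in faces -> G \subset F -> G \in faces
}.

Definition facets n (Delta : simplicial_complex n) : {set {set 'I_n}} :=
  [set F | maxset (mem (faces Delta)) F].

Lemma facet_exists n (Delta : simplicial_complex n) :
  exists F, F \in facets Delta.
Proof.
have [F mF _] := @maxset_exists _ (mem (faces Delta)) set0 (face0 Delta).
by exists F; rewrite inE.
Qed.

Definition facet_ideal (k : fieldType) n (F : {set 'I_n}) :
    {pred {mpoly k[n]}} :=
  ideal_gen [pred f : {mpoly k[n]} | [exists i, (i \notin F) && (f == 'X_i)]].
Arguments facet_ideal k {n} F.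

Definition second_symbolic_power (k : fieldType) n
    (Delta : simplicial_complex n) : {pred {mpoly k[n]}} :=
  [pred f | [forall F in facets Delta,
               f \in ideal_mul (facet_ideal k F) (facet_ideal k F)]].
Arguments second_symbolic_power k {n} Delta.

Lemma facet_ideal_coef0 (k : fieldType) n (F : {set 'I_n}) f :
  f \in facet_ideal k F -> f@_0%MM = 0.
Proof.
move=> /asboolP[r [c [g [gG ->]]]]; rewrite raddf_sum big1 //= => i _.
have /existsP[j /andP[_ /eqP->]] := gG i.
rewrite -[LHS]/(mcoeff 0%MM (c i * 'X_j)) rmorphM /= mcoeffX.
by rewrite mnm1_eq0 mulr0.
Qed.

Lemma second_symbolic_power_idealr (k : fieldType) n
  (Delta : simplicial_complex n) :
  idealr_closed (second_symbolic_power k Delta).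
Proof.
split.
- by apply/forall_inP => F _; apply: ideal_gen0.
- have [F FD] := facet_exists Delta.
  apply/negP => /forall_inP/(_ F FD)/asboolP[r [c [g [gG]]]].
  move=> /(congr1 (mcoeff 0%MM)).
  rewrite rmorph1 raddf_sum big1 => [/eqP|i _]; first by rewrite oner_eq0.
  have /asboolP[u [v [uP _ ->]]] := gG i.
  by rewrite /= !rmorphM /= (facet_ideal_coef0 uP) mul0r mulr0.
- move=> a u v /forall_inP uI /forall_inP vI; apply/forall_inP => F FD.
  by apply: ideal_gen_linear; [apply: uI | apply: vI].
Qed.

HB.instance Definition _ (k : fieldType) n (Delta : simplicial_complex n) :=
  isIdealr.Build {mpoly k[n]} (second_symbolic_power k Delta)
    (second_symbolic_power_idealr k Delta).

Definition one_dim_faces n (Delta : simplicial_complex n) : {set {set 'I_n}} :=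
  [set F in faces Delta | #|F| == 2%N].

Definition edge n (Delta : simplicial_complex n) : rel 'I_n :=
  fun i j => [set i; j] \in one_dim_faces Delta.

Definition graph_vertices n (Delta : simplicial_complex n) : {set 'I_n} :=
  \bigcup_(F in one_dim_faces Delta) F.

Section Distance.
Variables (T : finType) (V : {set T}) (e : rel T).

Definition joined_by_path (u v : T) (d : nat) : Prop :=
  exists p : seq T, [/\ path e u p, last u p = v & size p = d].

Definition distance (u v : T) (d : nat) : Prop :=
  joined_by_path u v d /\ forall d', joined_by_path u v d' -> (d <= d')%N.

(* An infinite distance makes this fail for every D; there is no condition
   when V is empty. *)
Definition diameter_le (D : nat) : Prop :=
  forall u v, u \in V -> v \in V -> exists2 d, distance u v d & (d <= D)%N.

End Distance.

(* Main.v *)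
Require Import Defs.
From mathcomp Require Import all_boot all_order all_algebra ring_quotient.
From mathcomp Require Import mpoly.
From mathcomp Require Import boolp.

(** Write R for S / I_Delta^(2) and m for the ideal of R generated by the
variables.  Suppose that u and v are vertices of Gamma whose closed stars have
no vertex in common, which is what a distance greater than 2 means.  Consider
the monomial x_u x_v on the punctured spectrum of R.  It lies in P_F^2 for each
facet F that avoids both u and v, and no facet contains both; the other facets
fall into those through u and those through v.  Since these two families share
no vertex they meet only at the origin, so the section that is x_u x_v on the
first family and 0 on the second is regular away from the origin.  This section
does not extend to R, which makes the first local cohomology of R at m nonzero
and forces the depth of m to be at most 1.  But Gamma has an edge {a, b}, and
the primes P_{a,b} < P_{a} < P_{} show that m has height at least 2, against
Cohen-Macaulayness.

In elementary terms, on the open set x_i <> 0 the section is s_i / x_i, where s_i is x_i x_u x_v when i lies in the star of u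
and 0 otherwise ([star_cocycle]).  The s_i agree on overlaps:
x_i s_j = x_j s_i in R ([star_cocycleP]).  As soon as m contains a regular
sequence of length 2, such a family has the form s_j = x_j t for one t in R
([koszul_exact_of_depth2]).  Here this is absurd: comparing the coefficients of
x_u x_v along a facet through u and along a facet through v, a polynomial
representing t would have to carry x_u x_v with coefficient both 1 and 0
([star_cocycle_not_exact]). *)

Set Implicit Arguments.
Unset Strict Implicit.
Unset Printing Implicit Defensive.

Import GRing.Theory.
Local Open Scope ring_scope.
Local Open Scope quotient_scope.

(** * Generated ideals and Koszul cocycles *)

Section GeneratedIdeals.
Variable R : comNzRingType.
Implicit Types (G P : {pred R}) (a b u v : R).

Lemma mem_ideal_gen G a u : u \in G -> a * u \in ideal_gen G.
Proof.
move=> uG; apply/asboolP; exists 1%N, (fun=> a), (fun=> u).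
by split=> //; rewrite big_ord1.
Qed.

Lemma ideal_genD G u v :
  u \in ideal_gen G -> v \in ideal_gen G -> u + v \in ideal_gen G.
Proof. by move=> uG vG; rewrite -[u]mul1r; apply: ideal_gen_linear. Qed.

Lemma ideal_genMl G a u : u \in ideal_gen G -> a * u \in ideal_gen G.
Proof. by move=> uG; rewrite -[_ * _]addr0 ideal_gen_linear ?ideal_gen0. Qed.

Lemma ideal_gen_ind G (K : R -> Prop) :
  K 0 -> (forall u v, K u -> K v -> K (u + v)) ->
  (forall a u, u \in G -> K (a * u)) ->
  forall u, u \in ideal_gen G -> K u.
Proof.
move=> K0 KD KM u /asboolP[r [c [g [gG ->]]]].
by elim/big_ind: _ => // i _; apply: KM.
Qed.

Lemma ideal_mulM (I J : {pred R}) a u v :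
  u \in I -> v \in J -> a * (u * v) \in ideal_mul I J.
Proof. by move=> uI vJ; apply/mem_ideal_gen/asboolP; exists u, v. Qed.

(** A cocycle s on the generators x extends linearly to their whole ideal: the
value sb at b = sum c_i x_i is sum c_i s_i.  That sum may depend on
the chosen expression of b, so sb is characterized by two compatibilities: one
with the generators, and one with any value y at a that is itself compatible
with the generators. *)
Lemma koszul_cocycle_extend (T : Type) (x s : T -> R) b :
  (forall i j, x i * s j = x j * s i) ->
  b \in ideal_gen [pred f | `[< exists i, f = x i >]] ->
  exists2 sb, forall j, x j * sb = b * s j
    & forall a y, (forall j, x j * y = a * s j) -> b * y = a * sb.
Proof.
move=> xs.
elim/ideal_gen_ind => [|b1 b2 [s1 xs1 s1P] [s2 xs2 s2P]|c _ /asboolP[i ->]].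
- by exists 0 => [j|a y _]; rewrite ?mulr0 !mul0r.
- exists (s1 + s2) => [j|a y ya]; first by rewrite mulrDr mulrDl xs1 xs2.
  by rewrite mulrDr mulrDl (s1P a) // (s2P a).
- exists (c * s i) => [j|a y ya]; first by rewrite mulrCA xs mulrA.
  by rewrite -mulrA ya mulrCA.
Qed.

(** If a, b begin a regular sequence, extend s to a and b; then
b * sa = a * sb, so regularity of b modulo a gives sa = a * t, and regularity
of a lets one cancel it in a * s_j = x_j * sa = a * (x_j * t).  This is the
vanishing of the first local cohomology in depth at least 2. *)
Lemma koszul_exact_of_depth2 (T : Type) (x s : T -> R) P d :
  {subset P <= ideal_gen [pred f | `[< exists i, f = x i >]]} ->
  regular_sequence_in P d -> (1 < d)%N ->
  (forall i j, x i * s j = x j * s i) ->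
  exists t, forall j, s j = x j * t.
Proof.
move=> Px [[|a [|b q]] [[_ reg] qP <-]] //= _ xs.
have /Px/(koszul_cocycle_extend xs)[sa xsa _] : a \in P.
  by rewrite qP ?inE ?eqxx.
have /Px/(koszul_cocycle_extend xs)[sb _ sbP] : b \in P.
  by rewrite qP ?inE ?eqxx ?orbT.
have areg y : a * y = 0 -> y = 0.
  move=> ay0; have /= := reg 0%N isT y; rewrite ay0 => /(_ (ideal_gen0 _)).
  by elim/ideal_gen_ind => // ? ? -> ->; apply: addr0.
have [t sat] : exists t, sa = a * t.
  have /= := reg 1%N isT sa; rewrite (sbP _ _ xsa) mulrC.
  have aG : a \in mem [:: a] by rewrite inE.
  move=> /(_ (mem_ideal_gen sb aG)).
  elim/ideal_gen_ind => [|_ _ [y ->] [z ->]|c w].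
  - by exists 0; rewrite mulr0.
  - by exists (y + z); rewrite mulrDr.
  - by rewrite inE => /eqP->; exists c; rewrite mulrC.
exists t => j; apply/eqP; rewrite -subr_eq0; apply/eqP/areg.
by rewrite mulrBr -xsa sat mulrCA subrr.
Qed.

End GeneratedIdeals.

(** * Ideals of a quotient ring *)

Section QuotientIdeals.
Variables (A : comNzRingType) (I : idealr A).
Local Notation R := {ideal_quot I}.
Implicit Types P : {pred A}.

(** The image of P in the quotient, given by representatives; it is meaningful
for P containing I, where [mem_quot_ideal] shows that any representative
decides membership. *)
Definition quot_ideal P : {pred R} := [pred r | repr r \in P].

Lemma mem_quot_ideal P f : idealr_closed P -> {subset I <= P} ->
  (\pi_R f \in quot_ideal P) = (f \in P).
Proof.
move=> [P0 _ Plin] IP; rewrite inE.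
have PB u v : u - v \in P -> v \in P -> u \in P.
  by move=> uv vP; rewrite -[u](subrK v) -[u - v]mul1r; apply: Plin.
have rf : repr (\pi_R f) - f \in I by rewrite Quotient.idealrBE reprK.
apply/idP/idP; apply: PB; apply: IP => //.
by rewrite -opprB rpredN.
Qed.

Lemma quot_ideal_closed P : idealr_closed P -> {subset I <= P} ->
  idealr_closed (quot_ideal P).
Proof.
move=> cP IP; have [P0 P1 Plin] := cP; split.
- by rewrite -(rmorph0 \pi_R) mem_quot_ideal.
- by rewrite -(rmorph1 \pi_R) mem_quot_ideal.
- move=> a u v; rewrite -[a]reprK -[u]reprK -[v]reprK -rmorphM -rmorphD.
  by rewrite !mem_quot_ideal //; apply: Plin.
Qed.

Lemma quot_ideal_prime P : prime_ideal P -> {subset I <= P} ->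
  prime_ideal (quot_ideal P).
Proof.
move=> [cP pP] IP; split; first exact: quot_ideal_closed.
move=> u v; rewrite -[u]reprK -[v]reprK -rmorphM !mem_quot_ideal //.
exact: pP.
Qed.

Lemma quot_ideal_maximal P : maximal_ideal P -> {subset I <= P} ->
  maximal_ideal (quot_ideal P).
Proof.
move=> [cP mP] IP; split; first exact: quot_ideal_closed.
move=> Q [Q0 Q1 Qlin] PQ r; rewrite -[r]reprK mem_quot_ideal //.
apply: (mP [pred f | \pi_R f \in Q]) => [|f fP].
  split; rewrite ?inE ?rmorph0 ?rmorph1 // => a u v; rewrite !inE.
  by rewrite rmorphD rmorphM; apply: Qlin.
by rewrite inE; apply: PQ; rewrite mem_quot_ideal.
Qed.

Lemma quot_ideal_sub P P' : {subset P <= P'} ->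
  {subset quot_ideal P <= quot_ideal P'}.
Proof. by move=> PP r; apply: PP. Qed.

End QuotientIdeals.

(** * Ideals generated by variables *)

Section CoordinateIdeals.
Variables (k : fieldType) (n : nat).
Local Notation S := {mpoly k[n]}.
Implicit Types (F G : {set 'I_n}) (f g : S) (m : 'X_{1..n}).

(** Substituting 0 for the variables outside F is the projection of S onto the
polynomial ring in the variables of F, with kernel P_F; primality of P_F is
read off from it, since S is a domain. *)
Definition kill F : n.-tuple S := [tuple if i \in F then 'X_i else 0 | i < n].

Lemma killX F i : 'X_i \mPo kill F = if i \in F then 'X_i else 0.
Proof. by rewrite comp_mpolyXU -tnth_nth tnth_mktuple. Qed.

Lemma facet_idealX F i : i \notin F -> 'X_i \in facet_ideal k F.
Proof.
move=> iF; rewrite -['X_i]mul1r; apply: mem_ideal_gen; apply/existsP.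
by exists i; rewrite iF eqxx.
Qed.

Lemma facet_ideal_ind F (K : S -> Prop) :
  K 0 -> (forall f g, K f -> K g -> K (f + g)) ->
  (forall f i, i \notin F -> K (f * 'X_i)) ->
  forall f, f \in facet_ideal k F -> K f.
Proof.
move=> K0 KD KX; apply: ideal_gen_ind => // f _ /existsP[i /andP[iF /eqP->]].
exact: KX.
Qed.

(** The polynomials f congruent to their image modulo P_F form a subring that
contains the constants and the variables. *)
Lemma sub_kill_facet_ideal F f : f - (f \mPo kill F) \in facet_ideal k F.
Proof.
pose K f := f - (f \mPo kill F) \in facet_ideal k F.
have KM g h : K g -> K h -> K (g * h).
  rewrite /K rmorphM /= => Kg Kh.
  (* Leibniz-type splitting of gh - g'h' as g(h - h') + h'(g - g'),
     where g' and h' are the images of g and h. *)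
  rewrite (_ : _ - _ = g * (h - (h \mPo kill F)) +
     (h \mPo kill F) * (g - (g \mPo kill F))).
    by apply: ideal_gen_linear; rewrite ?ideal_genMl.
  by rewrite !mulrBr [X in _ - X]mulrC addrA [_ * g]mulrC subrK mulrC.
have KC c : K c%:MP by rewrite /K comp_mpolyC subrr ideal_gen0.
rewrite -/(K f); elim/mpolyind: f => [|c m f _ _ Kf]; first by rewrite -mpolyC0.
rewrite /K comp_mpolyD opprD addrACA; apply: ideal_genD => //; rewrite -/(K _).
rewrite -mul_mpolyC; apply: (KM) => //; rewrite mpolyXE_id.
elim/big_ind: _ => [||i _]; [by rewrite -mpolyC1 | exact: KM |].
elim: (m i) => [|j Kj]; first by rewrite expr0 -mpolyC1.
rewrite exprS; apply: (KM) => //; rewrite /K killX.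
case: ifPn => [_|iF]; rewrite ?subrr ?subr0 ?ideal_gen0 //.
exact: facet_idealX.
Qed.

Lemma mem_facet_ideal F f : (f \in facet_ideal k F) = (f \mPo kill F == 0).
Proof.
apply/idP/eqP => [|f0]; last first.
  by have := sub_kill_facet_ideal F f; rewrite f0 subr0.
elim/facet_ideal_ind => [|g h g0 h0|g i iF]; first exact: comp_mpoly0.
  by rewrite comp_mpolyD g0 h0 addr0.
by rewrite rmorphM /= killX (negbTE iF) mulr0.
Qed.

Lemma facet_ideal_prime F : prime_ideal (facet_ideal k F).
Proof.
split; first split; rewrite ?mem_facet_ideal ?comp_mpoly0 //.
- by rewrite comp_mpoly1 oner_eq0.
- exact: ideal_gen_linear.
- by move=> f g; rewrite !mem_facet_ideal rmorphM /= mulf_eq0.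
Qed.

Lemma facet_ideal_mono F G : F \subset G ->
  {subset facet_ideal k G <= facet_ideal k F}.
Proof.
move=> /subsetP FG; apply: facet_ideal_ind => [|f g|f i iG].
- exact: ideal_gen0.
- exact: ideal_genD.
by apply/ideal_genMl/facet_idealX; apply: contraNN iG; apply: FG.
Qed.

Lemma sub_coef0_irrelevant f : f - (f@_0)%:MP \in facet_ideal k set0.
Proof.
elim/mpolyind: f => [|c m f _ _ Kf].
  by rewrite mcoeff0 mpolyC0 subr0 ideal_gen0.
rewrite mcoeffD mpolyCD opprD addrACA; apply: ideal_genD => //.
rewrite mcoeffZ mcoeffX; have [->|] := eqVneq m 0%MM.
  by rewrite mpolyX0 mulr1 alg_mpolyC subrr ideal_gen0.
rewrite mulr0 mpolyC0 subr0 -mdeg_eq0 mdegE sum_nat_eq0 negb_forall.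
move=> /existsP[i /= mi]; rewrite -(submK (m := U_(i)) (m' := m)) ?lep1mP //.
rewrite mpolyXD -mul_mpolyC mulrA; apply/ideal_genMl/facet_idealX.
by rewrite inE.
Qed.

(** An ideal containing all the variables contains the constant term of each of
its elements; a nonzero constant term would be a unit. *)
Lemma irrelevant_ideal_maximal :
  maximal_ideal (facet_ideal k (set0 : {set 'I_n})).
Proof.
have [cP _] := facet_ideal_prime set0; split=> // Q [Q0 Q1 Qlin] PQ f fQ.
have := sub_coef0_irrelevant f.
have [->|nz] := eqVneq (f@_0) 0; first by rewrite mpolyC0 subr0.
move=> /PQ f'Q; case/negP: Q1.
(* 1 = - c^-1 (f - c) + c^-1 f for the constant term c of f. *)
have := Qlin (- (f@_0)^-1%:MP) _ _ f'Q (Qlin (f@_0)^-1%:MP _ _ fQ Q0).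
rewrite addr0 mulNr mulrBr opprB subrK -mpolyCM mulVf // mpolyC1.
Qed.

(** * Order of vanishing along a coordinate subspace *)

Definition weight_off F m := (\sum_(i | i \notin F) m i)%N.

(** P_F^d lies in the ideal of polynomials of order at least d along F, and the
order is visible on coefficients. *)
Definition order_ge F d f := forall m, (weight_off F m < d)%N -> f@_m = 0.

Lemma weight_offD F m1 m2 :
  weight_off F (m1 + m2)%MM = (weight_off F m1 + weight_off F m2)%N.
Proof. by rewrite -big_split; apply: eq_bigr => i _; rewrite mnmDE. Qed.

Lemma weight_off1 F i : weight_off F U_(i)%MM = (i \notin F).
Proof.
rewrite /weight_off big_mkcond (bigD1 i) //= mnm1E eqxx big1 ?addn0.
  by case: (i \notin F).
by move=> j ji; rewrite mnm1E eq_sym (negbTE ji) if_same.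
Qed.

Lemma order_geD F d f g :
  order_ge F d f -> order_ge F d g -> order_ge F d (f + g).
Proof. by move=> fd gd m md; rewrite mcoeffD fd // gd // addr0. Qed.

Lemma order_geM F d e f g :
  order_ge F d f -> order_ge F e g -> order_ge F (d + e) (f * g).
Proof.
move=> fd ge m md; rewrite mcoeffM big1 // => -[k1 k2] /= /eqP mE.
have [/fd->|dk1] := ltnP (weight_off F k1) d; first by rewrite mul0r.
rewrite [g@__]ge ?mulr0 //.
move: md; rewrite [X in weight_off F X]mE weight_offD.
by apply: contraLR; rewrite -!leqNgt; apply: leq_add.
Qed.

Lemma facet_ideal_order F f : f \in facet_ideal k F -> order_ge F 1 f.
Proof.
elim/facet_ideal_ind => [m _|g h|g i iF]; first by rewrite mcoeff0.
  exact: order_geD.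
apply: (@order_geM F 0 1) => // m; rewrite mcoeffX; case: eqP => // <-.
by rewrite weight_off1 iF.
Qed.

Lemma facet_ideal_sqr_order F f :
  f \in ideal_mul (facet_ideal k F) (facet_ideal k F) -> order_ge F 2 f.
Proof.
elim/ideal_gen_ind => [m _|g h|g _ /asboolP[u [v [uF vF ->]]]].
- by rewrite mcoeff0.
- exact: order_geD.
apply: (@order_geM F 0 2) => //.
by apply: (@order_geM F 1 1); apply: facet_ideal_order.
Qed.

End CoordinateIdeals.

(** * Depth of the irrelevant ideal modulo the second symbolic power *)

Section SecondSymbolicPower.
Variables (k : fieldType) (n : nat) (Delta : simplicial_complex n).
Local Notation S := {mpoly k[n]}.
Local Notation I := (second_symbolic_power k Delta).
Local Notation R := {ideal_quot I}.
Implicit Types (F G : {set 'I_n}) (f : S) (a b i j u v w : 'I_n).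

Lemma face_sub_facet G :
  G \in faces Delta -> exists2 F, F \in facets Delta & G \subset F.
Proof.
move=> /(maxset_exists (P := mem (faces Delta)))[F mF GF].
by exists F; rewrite ?inE.
Qed.

Lemma facet_face F G : F \in facets Delta -> G \subset F -> G \in faces Delta.
Proof. by rewrite inE => /maxsetp FD; apply: faceS. Qed.

Lemma symbolic_power_sub_face G :
  G \in faces Delta -> {subset I <= facet_ideal k G}.
Proof.
move=> /face_sub_facet[F FD GF] f /forall_inP/(_ F FD) fF.
apply: (facet_ideal_mono GF); move: f fF.
apply: ideal_gen_ind => [|f g|c h /asboolP].
- exact: ideal_gen0.
- exact: ideal_genD.
by move=> [f [g [_ gF ->]]]; do 2!apply: ideal_genMl.
Qed.

Definition face_prime G : {pred R} := quot_ideal (I := I) (facet_ideal k G).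

(** The chain P_{a,b} < P_{a} < P_{}; each contains I_Delta^(2)
because it contains P_F for any facet F through a and b. *)
Lemma irrelevant_chain a b : a != b -> [set a; b] \in faces Delta ->
  prime_chain_below (face_prime set0) 2.
Proof.
move=> ab abD.
(* The default value of nth supplies the empty face at the top of the chain. *)
pose G l := nth set0 [:: [set a; b]; [set a]] l.
have GD l : G l \in faces Delta.
  rewrite /G; case: l => [|[|l]] //=; last by rewrite nth_nil face0.
  by apply: faceS abD _; rewrite sub1set !inE eqxx.
exists (fun l => face_prime (G l)); split=> // l.
  move=> _; apply: quot_ideal_prime; first exact: facet_ideal_prime.
  exact: symbolic_power_sub_face.
have strict (H G' : {set 'I_n}) c : G' \in faces Delta -> H \subset G' ->
    c \in G' -> c \notin H -> {subset face_prime G' <= face_prime H} /\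
      ~ {subset face_prime H <= face_prime G'}.
  move=> GD' HG cG cH; split; first exact/quot_ideal_sub/facet_ideal_mono.
  have HD : H \in faces Delta by apply: faceS GD' HG.
  have [[cPH _] [cPG _]] := (facet_ideal_prime k H, facet_ideal_prime k G').
  (* The variable x_c lies in P_H but not in P_G'. *)
  move=> /(_ (\pi_R 'X_c)); rewrite /face_prime.
  rewrite (mem_quot_ideal _ cPH (symbolic_power_sub_face HD)).
  rewrite (mem_quot_ideal _ cPG (symbolic_power_sub_face GD')).
  rewrite !mem_facet_ideal !killX cG (negbTE cH) eqxx => /(_ isT)/eqP.
  by move=> /(congr1 (mcoeff U_(c)))/eqP; rewrite mcoeffX eqxx mcoeff0 oner_eq0.
case: l => [|[|]] // _; [apply: (strict _ _ b) | apply: (strict _ _ a)];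
  rewrite ?GD // /G /= ?sub1set ?sub0set ?inE ?eqxx ?orbT //.
by rewrite eq_sym.
Qed.

Lemma irrelevant_generated :
  {subset face_prime set0 <=
    ideal_gen [pred r : R | `[< exists i, r = \pi_R 'X_i >]]}.
Proof.
move=> r; rewrite inE -{2}[r]reprK; move: (repr r).
apply: facet_ideal_ind => [|f g fG gG|f i _].
- by rewrite rmorph0 ideal_gen0.
- by rewrite rmorphD ideal_genD.
by rewrite rmorphM; apply/mem_ideal_gen/asboolP; exists i.
Qed.

Lemma depth_ge2 a b : cohen_macaulay_ideal I ->
  a != b -> [set a; b] \in faces Delta ->
  exists2 d, regular_sequence_in (face_prime set0) d & (1 < d)%N.
Proof.
move=> [_ CM] ab abD; have Imax := irrelevant_ideal_maximal k n.
have I0 := symbolic_power_sub_face (face0 Delta).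
have [d [_ ht] [reg _]] := CM _ (quot_ideal_maximal Imax I0).
by exists d => //; apply/ht/(irrelevant_chain ab).
Qed.

(** * The section supported on one of two disjoint stars *)

Section DisjointStars.
Variables u v : 'I_n.
Hypothesis disjoint_stars :
  forall w, [set u; w] \in faces Delta -> [set v; w] \notin faces Delta.

(** The numerators over x_i of the section that is x_u x_v on the facets through
u and 0 on the others; the failure of this section to extend
reflects that the union of the stars of u and v is disconnected. *)
Definition star_cocycle i : S :=
  if [set u; i] \in faces Delta then 'X_i * ('X_u * 'X_v) else 0.

Lemma facetN2 F i j : F \in facets Delta -> [set i; j] \notin faces Delta ->
  i \in F -> j \notin F.
Proof.
move=> FD ijD iF; apply: contraNN ijD => jF; apply: facet_face FD _.
by apply/subsetP => w; rewrite !inE => /orP[]/eqP->.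
Qed.

Lemma centersN : [set u; v] \notin faces Delta.
Proof.
apply/negP => uvD; have uD : [set u; u] \in faces Delta.
  by apply: faceS uvD _; rewrite setUid subsetUl.
by have /negP[] := disjoint_stars uD; rewrite setUC.
Qed.

(** Every facet misses two of the factors: j and v if it contains u, i and u if
it contains v, and u and v otherwise. *)
Lemma mixed_product_in_symbolic_power i j :
  [set u; i] \in faces Delta -> [set u; j] \notin faces Delta ->
  'X_j * ('X_i * ('X_u * 'X_v)) \in I.
Proof.
move=> uiD ujD; apply/forall_inP => F FD.
have XP w : w \notin F -> 'X_w \in facet_ideal k F by apply: facet_idealX.
have [uF|/XP uF] := boolP (u \in F).
  have /XP jF := facetN2 FD ujD uF; have /XP vF := facetN2 FD centersN uF.
  rewrite (_ : _ * _ = ('X_i * 'X_u) * ('X_j * 'X_v)); first exact: ideal_mulM.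
  by rewrite mulrACA [RHS]mulrACA [in RHS]mulrCA !mulrA.
have [vF|/XP vF] := boolP (v \in F); last by rewrite mulrA; apply: ideal_mulM.
have /XP iF := facetN2 FD (disjoint_stars uiD) vF.
rewrite (_ : _ * _ = ('X_j * 'X_v) * ('X_i * 'X_u)); first exact: ideal_mulM.
by rewrite -!mulrA; congr (_ * _); rewrite [RHS]mulrC !mulrA.
Qed.

Lemma star_cocycleP i j :
  \pi_R 'X_i * \pi_R (star_cocycle j) = \pi_R 'X_j * \pi_R (star_cocycle i).
Proof.
rewrite -!rmorphM; apply/eqP; rewrite -Quotient.idealrBE /star_cocycle.
case: ifPn => uj; case: ifPn => ui.
- by rewrite mulrCA subrr rpred0.
- by rewrite mulr0 subr0 mixed_product_in_symbolic_power.
- by rewrite mulr0 sub0r rpredN mixed_product_in_symbolic_power.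
- by rewrite !mulr0 subrr rpred0.
Qed.

(** Multiplication by x_w is injective modulo P_F^2 for a facet F through w, so
f itself has order at least 2 along F. *)
Lemma coef0_of_mul_vertex w f m : [set w] \in faces Delta -> f * 'X_w \in I ->
  (forall F, w \in F -> weight_off F m < 2)%N -> f@_m = 0.
Proof.
move=> /face_sub_facet[F FD]; rewrite sub1set => wF /forall_inP/(_ F FD).
move=> /facet_ideal_sqr_order fF mw; rewrite -(mcoeffMX _ U_(w)) addmC fF //.
by rewrite weight_offD weight_off1 wF addn0 mw.
Qed.

(** From x_v t = 0 and x_u t = x_u (x_u x_v), a representative of t has
coefficient 0 and 1 at x_u x_v, a monomial of weight at most 1 off any facet
through u or v. *)
Lemma star_cocycle_not_exact :
  [set u] \in faces Delta -> [set v] \in faces Delta ->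
  ~ exists t, forall j, \pi_R (star_cocycle j) = \pi_R 'X_j * t.
Proof.
move=> uD vD [t]; rewrite -[t]reprK; move: (repr t) => {t} f fP.
have fI j : star_cocycle j - f * 'X_j \in I.
  by rewrite Quotient.idealrBE mulrC rmorphM; apply/eqP.
pose m := (U_(u) + U_(v))%MM : 'X_{1..n}.
have mw F w : w \in [set u; v] -> w \in F -> (weight_off F m < 2)%N.
  rewrite weight_offD !weight_off1 !inE => /orP[]/eqP-> ->.
    by case: (v \in F).
  by rewrite addn0; case: (u \in F).
have := fI v; rewrite /star_cocycle (negbTE centersN) sub0r rpredN => fv.
have fm0 : f@_m = 0.
  apply: coef0_of_mul_vertex vD fv _ => F.
  by apply: mw; rewrite !inE eqxx orbT.
have := fI u; rewrite /star_cocycle setUid uD.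
rewrite [_ * ('X_u * 'X_v)]mulrC -mulrBl => fu.
have : ('X_u * 'X_v - f)@_m = 0.
  by apply: coef0_of_mul_vertex uD fu _ => F; apply: mw; rewrite !inE eqxx.
rewrite mcoeffB fm0 subr0 -mpolyXD mcoeffX eqxx => /eqP.
by rewrite oner_eq0.
Qed.

End DisjointStars.

Lemma common_closed_neighbour a b u v : cohen_macaulay_ideal I ->
  a != b -> [set a; b] \in faces Delta ->
  [set u] \in faces Delta -> [set v] \in faces Delta ->
  exists2 w, [set u; w] \in faces Delta & [set v; w] \in faces Delta.
Proof.
move=> CM ab abD uD vD.
have [/exists_inP[w uw vw]|disj] := boolP
  [exists (w | [set u; w] \in faces Delta), [set v; w] \in faces Delta].
  by exists w.
have {}disj w : [set u; w] \in faces Delta -> [set v; w] \notin faces Delta.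
  by move=> uw; apply: contraNN disj => vw; apply/exists_inP; exists w.
have [d reg d1] := depth_ge2 CM ab abD.
have [t tP] :=
  koszul_exact_of_depth2 irrelevant_generated reg d1 (star_cocycleP disj).
by case: (star_cocycle_not_exact disj uD vD); exists t.
Qed.

End SecondSymbolicPower.

(** * Distances in the graph *)

Lemma distance_le (T : finType) (e : rel T) u v D :
  (exists2 d, joined_by_path e u v d & (d <= D)%N) ->
  exists2 d, distance e u v d & (d <= D)%N.
Proof.
move=> [d0 jd0 d0D]; pose P d := `[< joined_by_path e u v d >].
have exP : exists d, P d by exists d0; apply/asboolP.
have [d /asboolP jd dmin] := ex_minnP exP.
exists d; first by split=> // d' jd'; apply/dmin/asboolP.
by apply: leq_trans d0D; apply/dmin/asboolP.
Qed.

Lemma edgeE n (Delta : simplicial_complex n) i j :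
  edge Delta i j = (i != j) && ([set i; j] \in faces Delta).
Proof. by rewrite /edge inE cards2 andbC; case: (i == j). Qed.

(** The vertex w may coincide with u or v; the corresponding half of
the walk is then empty instead of an edge. *)
Lemma joined_through n (Delta : simplicial_complex n) u v w :
  [set u; w] \in faces Delta -> [set v; w] \in faces Delta ->
  exists2 d, joined_by_path (edge Delta) u v d & (d <= 2)%N.
Proof.
move=> uw vw; pose hop (i j : 'I_n) := if i == j then [::] else [:: j].
have hopP i j : [set i; j] \in faces Delta ->
    [/\ path (edge Delta) i (hop i j), last i (hop i j) = j
      & (size (hop i j) <= 1)%N].
  by rewrite /hop; case: eqVneq => [->|ij] //= ijD; rewrite edgeE ij ijD.
have [p1 l1 s1] := hopP _ _ uw.
rewrite setUC in vw; have [p2 l2 s2] := hopP _ _ vw.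
exists (size (hop u w ++ hop w v)); last by rewrite size_cat (leq_add s1 s2).
by exists (hop u w ++ hop w v); rewrite cat_path last_cat l1 p1 p2 l2.
Qed.

Theorem corollary2p2 (k : fieldType) (n : nat) (Delta : simplicial_complex n) :
  cohen_macaulay_ideal (second_symbolic_power k Delta) ->
  diameter_le (graph_vertices Delta) (edge Delta) 2.
Proof.
move=> CM u v /bigcupP[A]; rewrite inE => /andP[AD /cards2P[a [b [ab AE]]]] uA.
move=> /bigcupP[B]; rewrite inE => /andP[BD _] vB; apply: distance_le.
have uD : [set u] \in faces Delta by apply: faceS AD _; rewrite sub1set.
have vD : [set v] \in faces Delta by apply: faceS BD _; rewrite sub1set.
rewrite AE in AD.
have [w uw vw] := common_closed_neighbour CM ab AD uD vD.
exact: joined_through uw vw.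
Qed.
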